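(* For every positive integer $z \neq 3$ there exists a graph $G$ with $\chi_c^\star(G)=z$, and there is no graph $G$ with $\chi_c^\star(G)=3$. That is, $\{\chi_c^\star(G) : G \text{ a finite graph}\}=\mathbb{Z}^+\setminus\{3\}$.
   Context: All graphs are finite and simple. For a graph $G$ and a positive integer $k$, a $k$-fold correspondence-cover of $G$ is a graph $H$ whose vertex set is partitioned into sets $L(v)=\{1_v,\dots,k_v\}$, $v\in V(G)$, such that each $L(v)$ is independent in $H$, there are no edges of $H$ between $L(u)$ and $L(v)$ when $uv\notin E(G)$, and for every edge $uv\in E(G)$ the edges of $H$ between $L(u)$ and $L(v)$ form a matching. A correspondence-colouring of $H$ is an independent set of $H$ containing exactly one vertex of each $L(v)$. A correspondence-packing of $H$ is a collection of $k$ pairwise disjoint correspondence-colourings of $H$ (so together they partition $V(H)$). The correspondence packing number $\chi_c^\star(G)$ is the least $k$ such that every $k$-fold correspondence-cover of $G$ admits a correspondence-packing. *)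

(* Defs.v *)
#[warnings="-notation-overridden"]
From mathcomp Require Import all_boot all_fingroup.
From mathcomp Require Import boolp.

Set Implicit Arguments.
Unset Strict Implicit.
Unset Printing Implicit Defensive.

Record graph (V : finType) := Graph {
  edge :> rel V;
  edge_sym : symmetric edge;
  edge_irrefl : irreflexive edge
}.

Definition independent (V : finType) (G : graph V) (A : {set V}) : Prop :=
  forall x y, x \in A -> y \in A -> ~~ G x y.

(* Intended for disjoint A and B: the edges between them are pairwise
   disjoint iff every vertex of A (resp. B) is in at most one of them. *)
Definition matching_between (V : finType) (G : graph V) (A B : {set V}) : Prop :=
  (forall x, x \in A -> #|[set y in B | G x y]| <= 1) /\
  (forall y, y \in B -> #|[set x in A | G x y]| <= 1).

(* The vertex i_v of a k-fold cover is encoded as the pair (v, i), with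
   labels running over 0, ..., k-1 instead of 1, ..., k. *)
Definition fiber (V : finType) (k : nat) (v : V) : {set V * 'I_k} :=
  [set x | x.1 == v].

Definition correspondence_cover (V : finType) (G : graph V) (k : nat)
    (H : graph (V * 'I_k)%type) : Prop :=
  [/\ forall v, independent H (fiber k v),
      forall u v, ~~ G u v ->
        forall x y, x \in fiber k u -> y \in fiber k v -> ~~ H x y
    & forall u v, G u v -> matching_between H (fiber k u) (fiber k v)].

Definition correspondence_colouring (V : finType) (k : nat)
    (H : graph (V * 'I_k)%type) (C : {set V * 'I_k}) : Prop :=
  independent H C /\ forall v, #|C :&: fiber k v| = 1.

Definition correspondence_packing (V : finType) (k : nat)
    (H : graph (V * 'I_k)%type) (C : 'I_k -> {set V * 'I_k}) : Prop :=
  (forall i, correspondence_colouring H (C i)) /\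
  (forall i j, i != j -> [disjoint C i & C j]).

Definition always_packs (V : finType) (G : graph V) (k : nat) : Prop :=
  0 < k /\
  forall H : graph (V * 'I_k)%type, correspondence_cover G H ->
    exists C, correspondence_packing H C.

Lemma avoiding_perm (k d : nat) (bad : rel 'I_k) :
  (forall i, #|[set j | bad i j]| <= d) ->
  (forall j, #|[set i | bad i j]| <= d) -> d + d < k ->
  exists s : 'S_k, forall i, ~~ bad i (s i).
Proof.
move=> badr badl dk.
pose B (s : 'S_k) := [set i | bad i (s i)].
case: (arg_minnP (fun s => #|B s|) (erefl : xpredT (1%g : 'S_k))) => s _ smin.
exists s => i; apply/negP => badi.
pose X := [set j | bad i (s j)]; pose Y := [set j | bad j (s i)].
have cX : #|X| <= d.
  have -> : X = s @^-1: [set j | bad i j] by apply/setP => j; rewrite !inE.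
  by rewrite on_card_preimset ?badr //; exists (s^-1)%g => x _; rewrite ?permK ?permKV.
have [j jXY] : exists j, j \notin X :|: Y.
  apply/existsP; rewrite -negb_forall; apply/negP => /forallP full.
  have : #|X :|: Y| < k.
    apply: leq_ltn_trans dk; apply: leq_trans (leq_card_setU _ _) _.
    exact: leq_add (badl _).
  have -> : X :|: Y = setT by apply/setP => x; rewrite full inE.
  by rewrite cardsT card_ord ltnn.
move: jXY; rewrite !inE negb_or => /andP[gij gji].
have := smin (tperm i j * s)%g isT; rewrite leqNgt => /negP; apply.
apply: proper_card; apply/properP; split; last first.
  by exists i; rewrite !inE // permM tpermL.
apply/subsetP => x; rewrite !inE permM.
by case: tpermP => [->|->|//]; [rewrite (negPf gij)|rewrite (negPf gji)].
Qed.

Lemma card_bigcup_le1 (T I : finType) (s : pred I) (F : I -> {set T}) :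
  (forall u, #|F u| <= 1) -> #|\bigcup_(u in s) F u| <= #|I|.
Proof.
move=> F1; apply: (@leq_trans (\sum_(u in s) 1)); last first.
  by rewrite sum1_card max_card.
elim/big_rec2: _ => [|u m A _ le]; first by rewrite cards0.
by apply: leq_trans (leq_card_setU _ _) _; rewrite leq_add.
Qed.

Lemma exists_always_packs (V : finType) (G : graph V) :
  exists k, always_packs G k.
Proof.
pose k := (#|V| + #|V|).+1; exists k; split=> // H [Hind Hnon Hmat].
have deg1 u v i : #|[set j | H (u, i) (v, j)]| <= 1.
  apply/card_le1_eqP => j j'; rewrite !inE => Hj Hj'.
  have [Guv|nG] := boolP (G u v); last first.
    by have := Hnon _ _ nG (u, i) (v, j); rewrite !inE !eqxx Hj => /(_ isT isT).
  have [/(_ (u, i))] := Hmat _ _ Guv; rewrite inE eqxx => /(_ isT) + _.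
  move=> /card_le1_eqP /(_ (v, j) (v, j')).
  by rewrite !inE eqxx Hj Hj' => /(_ isT isT) [].
have [p pP] : exists p : V -> 'S_k, forall u v i,
    u \in enum V -> v \in enum V -> ~~ H (u, p u i) (v, p v i).
  have := enum_uniq V; elim: (enum V) => [|v s IH] /=.
    by exists (fun=> 1%g).
  move=> /andP[vs us]; have [p pP] := IH us.
  pose bad i j := [exists u in s, H (u, p u i) (v, j)].
  have [||| t tP] := @avoiding_perm k #|V| bad.
  - move=> i.
    have -> : [set j | bad i j]
      = \bigcup_(u in s) [set j | H (u, p u i) (v, j)].
      apply/setP => j; rewrite inE; apply/exists_inP/bigcupP => -[u us' Hu];
        by exists u; rewrite // ?inE in Hu *.
    by apply: (@card_bigcup_le1 _ _ (mem s)) => u; exact: deg1.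
  - move=> j.
    have -> : [set i | bad i j]
      = \bigcup_(u in s) [set i | H (u, p u i) (v, j)].
      apply/setP => i; rewrite inE; apply/exists_inP/bigcupP => -[u us' Hu];
        by exists u; rewrite // ?inE in Hu *.
    apply: (@card_bigcup_le1 _ _ (mem s)) => u.
    have -> : [set i | H (u, p u i) (v, j)]
      = p u @^-1: [set i | H (v, j) (u, i)].
      by apply/setP => i; rewrite !inE edge_sym.
    rewrite on_card_preimset; first exact: deg1.
    by exists ((p u)^-1)%g => x _; rewrite ?permK ?permKV.
  - exact: ltnSn.
  exists (fun u => if u == v then t else p u) => x y i.
  have good u : u \in s -> ~~ H (u, p u i) (v, t i).
    by move=> us'; apply: contra (tP i) => Hu; apply/exists_inP; exists u.
  rewrite !inE; case: eqVneq => [->|xv]; case: eqVneq => [->|yv] //=.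
  - by move=> *; rewrite edge_irrefl.
  - by move=> _ ys; rewrite edge_sym good.
  - by move=> xs _; rewrite good.
  - exact: pP.
exists (fun i => [set x | x.2 == p x.1 i]); split=> [i|i j ij].
  split=> [[u a] [v b]|v].
    by rewrite !inE /= => /eqP-> /eqP->; apply: pP; rewrite mem_enum.
  apply/eqP/cards1P; exists (v, p v i); apply/setP => -[u a].
  rewrite !inE /= xpair_eqE andbC.
  by case: eqVneq => // ->.
rewrite disjoint_subset; apply/subsetP => -[u a]; rewrite !inE /= => /eqP->.
by rewrite (inj_eq perm_inj).
Qed.

Lemma exists_always_packsb (V : finType) (G : graph V) :
  exists k, `[< always_packs G k >].
Proof. by have [k kP] := exists_always_packs G; exists k; apply/asboolP. Qed.

Definition correspondence_packing_number (V : finType) (G : graph V) : nat :=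
  ex_minn (exists_always_packsb G).

(* Main.v *)
(** Parametrise the covers of [G] by permutations attached to the edges.  If some
   signing of the edges of [G] is not a vertex coboundary, then turning the
   negative edges of a 3-fold cover into transpositions excludes a packing, as
   fixed-point-free permutations of three labels are even; otherwise [G] packs
   for [k = 2].  So 3 is never attained.

   In the complete bipartite graph with left side of size [d] and a huge right
   side, every [d]-tuple of permutations on the left can be blocked at some right
   vertex.  A blocked tuple exists iff [k < 2 d], which gives the value [2 d].
   For [k = 2 d - 1] a blocked tuple contains a Latin square of order [d], which
   is far rarer than the Latin rectangles blocking for [k = 2 d - 2].  Hence the
   largest right side for which the union bound gives a packing at [k = 2 d - 1]
   is already large enough for a greedy covering to exclude one at
   [k = 2 d - 2]; the disjoint union with the graph for [2 (d - 1)] has value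
   [2 d - 1], for every [d >= 3]. *)
Require Import Defs.
From Stdlib Require Import ZArith.
From mathcomp Require Import all_boot all_order all_fingroup all_algebra.
From mathcomp Require Import boolp zify ring.

Set Implicit Arguments.
Unset Strict Implicit.
Unset Printing Implicit Defensive.

(** * Covers as permutations on the edges *)

(** Minimise the disagreeing rows. If [r i j] but [s i != j], swapping the images of [i] and
    [s^-1 j] repairs row [i] and spoils no other, since [j] is matched to [i]. *)
Lemma matching_perm k (r : rel 'I_k) :
  (forall i j j', r i j -> r i j' -> j = j') ->
  (forall i i' j, r i j -> r i' j -> i = i') ->
  exists s : 'S_k, forall i j, r i j -> s i = j.
Proof.
move=> rR rL; pose B (s : 'S_k) := [set i | [exists j, r i j && (s i != j)]].
case: (arg_minnP (fun s => #|B s|) (erefl : xpredT (1%g : 'S_k))) => s _ smin.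
exists s => i j rij; apply/eqP; apply: contraT => sij.
have := smin (tperm i (s^-1 j) * s)%g isT; rewrite leqNgt => /negP; case.
have ii' : s^-1%g j != i by apply: contra sij => /eqP <-; rewrite permKV.
apply: proper_card; apply/properP; split; last first.
  exists i; rewrite inE; first by apply/existsP; exists j; rewrite rij.
  apply/existsP => -[j1 /andP[/(rR _ _ _ rij) <-]].
  by rewrite permM tpermL permKV eqxx.
apply/subsetP => x; rewrite !inE => /existsP[j1 /andP[rx]]; rewrite permM.
case: tpermP => [xi|xi|_ _ sx]; last by apply/existsP; exists j1; rewrite rx.
  by move: rx; rewrite xi => /(rR _ _ _ rij) <-; rewrite permKV eqxx.
move=> _; apply/existsP; exists j1; rewrite rx /= xi permKV.
by apply: contra ii' => /eqP jj1; rewrite -xi (rL _ _ _ rij (_ : r x j)) // jj1.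
Qed.

(** Packing for covers whose matchings are all perfect: [s u v] is the matching across [uv], and
    [p v i] the label of [v] in the [i]-th colouring. *)
Definition packs_twists (V : finType) (G : graph V) (k : nat) : Prop :=
  forall s : V -> V -> 'S_k, (forall u v, s v u = (s u v)^-1%g) ->
  exists p : V -> 'S_k, forall u v, G u v -> forall i, p v i != s u v (p u i).

Lemma twist_edge_sym (V : finType) (G : graph V) k (s : V -> V -> 'S_k) :
  (forall u v, s v u = (s u v)^-1%g) ->
  symmetric (fun x y : V * 'I_k => G x.1 y.1 && (y.2 == s x.1 y.1 x.2)).
Proof.
move=> sV [u i] [v j] /=; rewrite edge_sym sV; congr (_ && _).
by apply/eqP/eqP => ->; rewrite ?permK ?permKV.
Qed.

Lemma twist_edge_irrefl (V : finType) (G : graph V) k (s : V -> V -> 'S_k) :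
  irreflexive (fun x y : V * 'I_k => G x.1 y.1 && (y.2 == s x.1 y.1 x.2)).
Proof. by move=> [u i] /=; rewrite edge_irrefl. Qed.

Definition twist_cover (V : finType) (G : graph V) k (s : V -> V -> 'S_k)
    (sV : forall u v, s v u = (s u v)^-1%g) : graph (V * 'I_k)%type :=
  Graph (twist_edge_sym G sV) (twist_edge_irrefl G s).

Lemma twist_coverP (V : finType) (G : graph V) k (s : V -> V -> 'S_k)
    (sV : forall u v, s v u = (s u v)^-1%g) :
  correspondence_cover G (twist_cover G sV).
Proof.
split=> [v [x i] [y j]|u v Guv [x i] [y j]|u v Guv].
- by rewrite !inE /= => /eqP-> /eqP->; rewrite edge_irrefl.
- by rewrite !inE /= => /eqP-> /eqP->; rewrite (negPf Guv).
have H1 b (x : V * 'I_k) :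
    #|[set y in fiber k b | twist_cover G sV x y]| <= 1.
  apply/card_le1_eqP => -[y1 j1] [y2 j2]; rewrite !inE /=.
  by move=> /and3P[/eqP-> _ /eqP->] /and3P[/eqP-> _ /eqP->].
split=> x xf; first exact: (H1 v).
rewrite (_ : [set _ in _ | _] = [set y in fiber k u | twist_cover G sV x y]).
  exact: (H1 u).
by apply/setP => y; rewrite !inE /= twist_edge_sym.
Qed.

Lemma packing_perms (V : finType) k (H : graph (V * 'I_k)%type) C :
  correspondence_packing H C ->
  exists p : V -> 'S_k, forall u v i, ~~ H (u, p u i) (v, p v i).
Proof.
move=> [Ccol Cdis].
have Cex v i : exists j, (v, j) \in C i.
  have [_ /(_ v) /eqP/cards1P[[u j] eqC]] := Ccol i.
  have := set11 (u, j); rewrite -eqC !inE /= => /andP[uC /eqP uv].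
  by exists j; rewrite -uv.
pose f v i := xchoose (Cex v i); have fP v i := xchooseP (Cex v i).
have finj v : injective (f v).
  move=> i j fij; apply/eqP; apply: contraT => /Cdis; rewrite disjoint_subset => /subsetP /(_ _ (fP v i)).
  by rewrite inE /= -/(f v i) fij fP.
exists (fun v => perm (finj v)) => u v i; rewrite !permE.
by have [Cind _] := Ccol i; apply: Cind; apply: fP.
Qed.

Lemma perms_packing (V : finType) k (H : graph (V * 'I_k)%type) (p : V -> 'S_k) :
  (forall u v i, ~~ H (u, p u i) (v, p v i)) ->
  correspondence_packing H (fun i => [set x | x.2 == p x.1 i]).
Proof.
move=> pP; split=> [i|i j ij].
  split=> [[u a] [v b]|v]; first by rewrite !inE /= => /eqP-> /eqP->; apply: pP.
  apply/eqP/cards1P; exists (v, p v i); apply/setP => -[u a].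
  by rewrite !inE /= xpair_eqE andbC; case: eqVneq => // ->.
rewrite disjoint_subset; apply/subsetP => -[u a]; rewrite !inE /= => /eqP->.
by rewrite (inj_eq perm_inj).
Qed.

Lemma cover_perm (V : finType) (G : graph V) k (H : graph (V * 'I_k)%type) u v :
  correspondence_cover G H ->
  exists s : 'S_k, forall i j, H (u, i) (v, j) -> s i = j.
Proof.
move=> [_ Hnon Hmat].
have [Guv|nG] := boolP (G u v); last first.
  exists 1%g => i j Hij; have := Hnon _ _ nG (u, i) (v, j).
  by rewrite !inE !eqxx Hij => /(_ isT isT).
have [HR HL] := Hmat _ _ Guv; apply: (@matching_perm k (fun i j => H (u, i) (v, j))).
  move=> i j j' Hj Hj'; have := HR (u, i); rewrite inE eqxx => /(_ isT)/card_le1_eqP.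
  by move=> /(_ (v, j) (v, j')); rewrite !inE eqxx Hj Hj' => /(_ isT isT) [].
move=> i i' j Hj Hj'; have := HL (v, j); rewrite inE eqxx => /(_ isT)/card_le1_eqP.
by move=> /(_ (u, i) (u, i')); rewrite !inE eqxx Hj Hj' => /(_ isT isT) [].
Qed.

(** Enlarging matchings only makes packing harder, so each may be completed to a permutation. *)
Lemma always_packsP (V : finType) (G : graph V) k :
  always_packs G k <-> 0 < k /\ packs_twists G k.
Proof.
split=> -[k0 pk]; split=> //.
  move=> s sV; have [C /packing_perms[p pP]] := pk _ (twist_coverP G sV).
  by exists p => u v Guv i; have := pP u v i; rewrite /= Guv.
move=> H Hcov.
have [|s0 s0P] := @choice (V * V) 'S_k (fun uv s =>
  forall i j, H (uv.1, i) (uv.2, j) -> s i = j).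
  by case=> u v; exact: (cover_perm u v Hcov).
(* The completions for [(u, v)] and [(v, u)] need not be inverse, so only one of them is kept. *)
pose s u v := if enum_rank u < enum_rank v then s0 (u, v)
  else if enum_rank v < enum_rank u then ((s0 (v, u))^-1)%g else 1%g.
have sV u v : s v u = ((s u v)^-1)%g.
  by rewrite /s; case: ltngtP; rewrite ?invgK ?invg1.
have [p pP] := pk _ sV; exists (fun i => [set x | x.2 == p x.1 i]).
apply: perms_packing => u v i; apply/negP => Huv.
have [_ Hnon _] := Hcov.
have [Guv|nG] := boolP (G u v); last first.
  by have := Hnon _ _ nG (u, p u i) (v, p v i); rewrite !inE !eqxx Huv => /(_ isT isT).
have /eqP[] := pP u v Guv i; rewrite /s; case: ltngtP => [_|_|/ord_inj/enum_rank_inj uv].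
- by rewrite (s0P (u, v) _ _ Huv).
- by move: Huv; rewrite edge_sym => /(s0P (v, u)) <-; rewrite permK.
- by rewrite uv edge_irrefl in Guv.
Qed.

(** * Signings, and why 3 is not a value *)

Lemma ord2_or (i j : 'I_2) : i != j -> forall x, x = i \/ x = j.
Proof.
move=> ij x; case: (eqVneq x i) => [->|xi]; [by left|right].
apply/val_inj; move: ij xi; rewrite -!val_eqE /=.
by case: i j x => [[|[]] // ?] [[|[]] // ?] [[|[]] // ?].
Qed.

Lemma perm2_fix (s : 'S_2) i : s i = i -> s = 1%g.
Proof.
move=> si; apply/permP => x; rewrite perm1.
have [-> //|xi] := eqVneq x i.
have [|sx|//] := @ord2_or i x _ (s x); first by rewrite eq_sym.
by move: sx xi; rewrite -[RHS]si => /perm_inj ->; rewrite eqxx.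
Qed.

(** A 2-cycle would leave the third point fixed, so [s ^+ 3 = 1] and the sign is trivial. *)
Lemma derangement3_even (s : 'S_3) : (forall i, s i != i) -> odd_perm s = false.
Proof.
move=> sD; have no4 (l : seq 'I_3) : uniq l -> size l <= 3.
  by move=> /card_uniqP <-; rewrite -[leqRHS]card_ord max_card.
have s2 x : s (s x) != x.
  apply/negP => /eqP ssx.
  have [y] : exists y, y \notin [:: x; s x].
    apply/existsP; rewrite -negb_forall; apply/negP => /forallP full.
    have : #|'I_3| <= size [:: x; s x].
      by apply: leq_trans (card_size _); apply/subset_leq_card/subsetP => y _.
    by rewrite card_ord.
  rewrite !inE negb_or => /andP[yx ysx].
  have /no4 // : uniq [:: s y; y; x; s x].
  rewrite /= !inE !negb_or sD yx ysx (inj_eq perm_inj) yx [x == _]eq_sym sD.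
  by rewrite -{1}ssx (inj_eq perm_inj) ysx.
have s3 : (s ^+ 3 = 1)%g.
  apply/permP => x; rewrite perm1 permX /=; apply/eqP; apply: contraT => s3x.
  have /no4 // : uniq [:: s (s (s x)); s (s x); s x; x].
  by rewrite /= !inE !negb_or !sD !s2 s3x.
have := congr1 (@odd_perm _) s3; rewrite odd_perm1 !expgS expg0 mulg1 !odd_permM.
by case: odd_perm.
Qed.

(** With [eps] marking the negative edges, a signed graph is balanced when its signs are the
    coboundary of a vertex function. *)
Definition unbalanced_signing (V : finType) (G : graph V) (eps : rel V) : Prop :=
  symmetric eps /\
  forall f : V -> bool, exists u v, G u v /\ f u (+) f v != eps u v.

(** In a packing, [(p v)^-1 * p u] times the twist of the edge is a derangement, hence even; the
    signs of the [p v] would then have coboundary [eps]. *)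
Lemma unbalanced_not_packs3 (V : finType) (G : graph V) eps :
  unbalanced_signing G eps -> ~ packs_twists G 3.
Proof.
move=> [epsC epsU] pk.
pose t : 'S_3 := tperm ord0 ord_max.
have [u v|p pP] := pk (fun u v => if eps u v then t else 1%g).
  by rewrite epsC; case: ifP; rewrite ?tpermV ?invg1.
have [u [v [Guv /eqP[]]]] := epsU (fun v => odd_perm (p v)).
have : odd_perm ((p v)^-1 * (p u * (if eps u v then t else 1)))%g = false.
  apply: derangement3_even => i; rewrite !permM eq_sym.
  by have := pP u v Guv ((p v)^-1 i)%g; rewrite permKV.
rewrite !odd_permM odd_permV (_ : odd_perm (if _ then _ else _) = eps u v).
  by case: (odd_perm _) (odd_perm _) (eps u v) => [] [] [].
by case: ifP; rewrite ?odd_tperm ?odd_perm1.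
Qed.

(** A cycle, given as a vertex [v] with two neighbours joined inside a set [A] avoiding [v], becomes
    unbalanced when one of its edges is the only negative one. In a forest the vertices are added
    one at a time. *)
Lemma unbalanced_or_packs2 (V : finType) (G : graph V) :
  (exists eps, unbalanced_signing G eps) \/ packs_twists G 2.
Proof.
pose within (A : {set V}) := [rel x y | [&& x \in A, y \in A & G x y]].
have [[A [v [u [u' [vA uA u'A [uu' Gvu Gvu' uu'c]]]]]]|nocyc] :=
  pselect (exists (A : {set V}) v u u', [/\ v \notin A, u \in A, u' \in A &
    [/\ u != u', G v u, G v u' & connect (within A) u u']]).
  left; exists (fun x y => ((x == v) && (y == u)) || ((x == u) && (y == v))).
  split=> [x y|f]; first by rewrite orbC ![_ && (_ == v)]andbC andbC.
  apply: contrapT => bal.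
  have {}bal x y : G x y ->
      f x (+) f y = ((x == v) && (y == u)) || ((x == u) && (y == v)).
    by move=> Gxy; apply/eqP; apply: contraT => ne; case: bal; exists x, y.
  have fc x y : connect (within A) x y -> f x = f y.
    move=> /connectP[l]; elim: l x => [|z l IH] x /= => [_ -> //|].
    move=> /andP[/and3P[xA zA /bal]] + zl yl; rewrite -(IH z zl yl).
    have -> : x == v = false by apply/negP => /eqP xv; rewrite xv (negPf vA) in xA.
    have -> : z == v = false by apply/negP => /eqP zv; rewrite zv (negPf vA) in zA.
    by rewrite andbF; case: (f x) (f z) => [] [].
  have := bal _ _ Gvu'; rewrite -(fc _ _ uu'c) (bal _ _ Gvu) !eqxx.
  rewrite [u' == u]eq_sym (negPf uu') [v == u](_ : _ = false) //.
  by apply/negP => /eqP vu; rewrite vu uA in vA.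
right=> s sV.
suff [p pP] : exists p : V -> 'S_2, forall u v, u \in enum V -> v \in enum V ->
    G u v -> forall i, p v i != s u v (p u i).
  by exists p => u v; apply: pP; rewrite mem_enum.
elim: (enum V) (enum_uniq V) => [|v l IH] /=; first by exists (fun=> 1%g).
move=> /andP[vl /IH[p pP]]; pose A := [set x in l].
(* [flip u] records a conflict between [u] and [v] when [v] gets [1%g], and [g] marks the components
   of [A] with such a neighbour. Exchanging the two colourings there keeps inner edges valid and
   cures the conflicts, as [v] has at most one neighbour per component. *)
pose flip u := ~~ [forall i, i != s u v (p u i)].
pose g w := [exists u in A, [&& G v u, connect (within A) u w & flip u]].
pose t : 'S_2 := tperm ord0 ord_max.
have tD i : t i != i.
  rewrite /t; have [->|->] := @ord2_or ord0 ord_max isT i.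
    by rewrite tpermL.
  by rewrite tpermR.
exists (fun w => if w == v then 1%g else if g w then (t * p w)%g else p w).
have gE x y : x \in l -> y \in l -> G x y -> g x = g y.
  move=> xl yl Gxy; apply: eq_existsb => u; congr [&& _, _, _ & _].
  apply/idP/idP => h; apply: (connect_trans h); apply: connect1.
    by rewrite /= !inE xl yl.
  by rewrite /= !inE xl yl edge_sym.
have gv y : y \in l -> G v y -> g y = flip y.
  move=> yl Gvy; apply/idP/idP => [/existsP[u /and4P[uA Gvu uy fu]]|fy].
    have [-> //|uy'] := eqVneq y u; case: nocyc; exists A, v, u, y.
    by split; rewrite // ?inE //; split=> //; rewrite eq_sym.
  by apply/existsP; exists y; rewrite inE yl Gvy connect0.
have key y : y \in l -> G v y -> forall i,
    i != s y v ((if g y then (t * p y)%g else p y) i).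
  move=> yl Gvy i; rewrite gv //; case: ifP => [|/negbFE/forallP //].
  rewrite /flip negb_forall => /existsP[j]; rewrite negbK => /eqP sj.
  have /permP/(_ (t i)) : (p y * s y v)%g = 1%g by apply: (@perm2_fix _ j); rewrite permM.
  by rewrite !permM perm1 => ->; rewrite eq_sym.
move=> x y; rewrite !inE; case: eqVneq => [->|xv] /=; case: eqVneq => [->|yv] //=.
- by rewrite edge_irrefl.
- move=> _ yl Gvy i; rewrite perm1; apply: contra (key y yl Gvy i) => /eqP->.
  by rewrite (sV v y) permK.
- by move=> xl _ Gxv i; rewrite perm1 key // edge_sym.
move=> xl yl Gxy i; rewrite (gE _ _ xl yl Gxy).
by case: ifP => _; rewrite ?permM pP.
Qed.

(** * Tuples of permutations that block a vertex *)

(** If a permutation with fewest bad points has a bad point [i], the points that [i] cannot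
    profitably be swapped with form two sets of size at most [d], both containing [i]. They cover
    everything, so [d + d >= k.+1], and equality is rigid enough to yield [S] and [T]. *)
Lemma avoiding_perm_or_block k d (bad : rel 'I_k) :
  (forall i, #|[set j | bad i j]| <= d) ->
  (forall j, #|[set i | bad i j]| <= d) -> d + d <= k.+1 ->
  (exists s : 'S_k, forall i, ~~ bad i (s i)) \/
  (d + d = k.+1 /\ exists S T : {set 'I_k},
     [/\ #|S| = d, #|T| = d & forall i j, i \in S -> j \in T -> bad i j]).
Proof.
move=> badr badl dk; pose B (s : 'S_k) := [set i | bad i (s i)].
case: (arg_minnP (fun s => #|B s|) (erefl : xpredT (1%g : 'S_k))) => s _ smin.
have [B0|[i]] := set_0Vmem (B s).
  by left; exists s => i; have := in_set0 i; rewrite -B0 inE => ->.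
rewrite inE => badi; right.
pose X (t : 'S_k) := [set j | bad i (t j)].
pose Y (t : 'S_k) := [set j | bad j (t i)].
have cX t : #|X t| <= d.
  have -> : X t = t @^-1: [set j | bad i j] by apply/setP => j; rewrite !inE.
  by rewrite on_card_preimset ?badr //; exists (t^-1)%g => x _; rewrite ?permK ?permKV.
(* Swapping the images of [i] and of a point outside [X t :|: Y t] removes a
   bad pair, so minimality forces [X t] and [Y t] to overlap in [i] only. *)
have XY t : #|B t| = #|B s| -> bad i (t i) ->
    [/\ d + d = k.+1, #|X t| = d, #|Y t| = d & Y t = i |: ~: X t].
  move=> tmin badt.
  have full : X t :|: Y t = setT.
    apply/setP => j; rewrite inE [RHS]inE; apply: contraT.
    rewrite !inE negb_or => /andP[gij gji].
    have := smin (tperm i j * t)%g isT; rewrite leqNgt -tmin => /negP; case.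
    apply: proper_card; apply/properP; split; last first.
      by exists i; rewrite !inE // permM tpermL.
    apply/subsetP => x; rewrite !inE permM.
    by case: tpermP => [->|->|//]; [rewrite (negPf gij)|rewrite (negPf gji)].
  have iXY : i \in X t :&: Y t by rewrite !inE badt.
  have cXY : 0 < #|X t :&: Y t| by apply/card_gt0P; exists i.
  have := cardsUI (X t) (Y t); rewrite full cardsT card_ord.
  move=> eqk; have arith a b c : a <= d -> b <= d -> 0 < c -> k + c = a + b ->
    [/\ d + d = k.+1, c <= 1, a = d & b = d] by move=> *; split; lia.
  have [dk' cXY1 EX EY] := arith _ _ _ (cX t) (badl (t i)) cXY eqk.
  split=> //.
  apply/setP => j; rewrite in_setU1 in_setC.
  have := in_setT j; rewrite -full in_setU.
  have [-> _|ji] := eqVneq j i; first by move: iXY; rewrite inE => /andP[].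
  case: (boolP (j \in X t)) => //= jX _.
  apply/negP => jY; move: ji => /eqP; apply.
  by have /card_le1_eqP := cXY1; apply; rewrite // inE jX.
have [dk' cXs cYs eY] := XY s erefl badi.
split=> //; exists (Y s), (s @: X s).
split=> //; first by rewrite card_imset //; exact: perm_inj.
move=> y _ yY /imsetP[j jX ->].
have [-> |ji] := eqVneq j i; first by move: yY; rewrite inE.
(* As [j] lies in [X s], [t] is again minimal and [X t = X s]. Hence [Y t = Y s]: each row of [Y s]
   is bad at [s j]. *)
pose t := (tperm i j * s)%g.
have ti : t i = s j by rewrite permM tpermL.
have badt : bad i (t i) by rewrite ti; rewrite inE in jX.
have jnY : j \notin Y s by rewrite eY !inE negb_or ji negbK; rewrite inE in jX.
have tmin : #|B t| = #|B s|.
  apply/eqP; rewrite eqn_leq smin // andbT subset_leq_card //.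
  apply/subsetP => x; rewrite !inE permM.
  by case: tpermP => [-> _ //|->|//]; move: jnY; rewrite inE => /negPf->.
have [_ _ _ eYt] := XY t tmin badt.
have eX : X t = X s.
  apply/setP => x; rewrite !inE permM.
  by case: tpermP => [->|->|//]; rewrite badi; move: jX; rewrite inE => ->.
by move: yY; rewrite eY -eX -eYt inE ti.
Qed.

Section Bicliques.
Variables (d k : nat).
Implicit Types p s : {ffun 'I_d -> 'S_k}.

(** [p j i] is the label that left vertex [j] forbids to a right vertex in colouring [i]; [t] is a
    candidate permutation at that right vertex. *)
Definition blocked p := [forall t : 'S_k, exists i, exists j, t i == p j i].

Definition twist s p : {ffun 'I_d -> 'S_k} := [ffun j => (p j * s j)%g].

Definition row_image p (i : 'I_k) : {set 'I_k} := [set p j i | j : 'I_d].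

(** When [#|T| = d], the entries [p j i] with [i] in [S] form a Latin rectangle on the symbols [T]:
    no column repeats a symbol, as [p j] is injective. *)
Definition latin (S T : {set 'I_k}) : {set {ffun 'I_d -> 'S_k}} :=
  [set p | [forall i in S, row_image p i == T]].

Lemma latinP (S T : {set 'I_k}) p :
  reflect (forall i, i \in S -> row_image p i = T) (p \in latin S T).
Proof. by rewrite inE; apply: (iffP forall_inP) => h i /h /eqP. Qed.

Lemma card_row_image p i : #|row_image p i| <= d.
Proof. by apply: leq_trans (leq_imset_card _ _) _; rewrite card_ord. Qed.

Lemma card_col_image p l : #|[set i | l \in row_image p i]| <= d.
Proof.
apply: (@leq_trans #|[set ((p j)^-1)%g l | j : 'I_d]|).
  apply/subset_leq_card/subsetP => i; rewrite inE => /imsetP[j _ ->].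
  by apply/imsetP; exists j; rewrite ?permK.
by apply: leq_trans (leq_imset_card _ _) _; rewrite card_ord.
Qed.

Lemma blocked_latin p : d + d <= k.+1 -> blocked p ->
  d + d = k.+1 /\ exists S T : {set 'I_k}, [/\ #|S| = d, #|T| = d & p \in latin S T].
Proof.
move=> dk /forallP pb; pose bad i l := l \in row_image p i.
have [||[t tP]|[dk' [S [T [cS cT ST]]]]] := @avoiding_perm_or_block k d bad _ _ dk.
- move=> i; apply: leq_trans (card_row_image p i).
  by apply/subset_leq_card/subsetP => l; rewrite inE.
- exact: card_col_image.
- have /existsP[i /existsP[j /eqP tij]] := pb t.
  by have /negP[] := tP i; apply/imsetP; exists j.
split=> //; exists S, T; split=> //; apply/latinP => i iS.
apply/esym/eqP; rewrite eqEcard cT card_row_image andbT.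
by apply/subsetP => l; apply: ST.
Qed.

(** Pigeonhole: a permutation avoiding [p] would map [S] into the complement of [T], which is too
    small. *)
Lemma latin_blocked (S T : {set 'I_k}) p :
  k < #|S| + #|T| -> p \in latin S T -> blocked p.
Proof.
move=> cST /latinP pST; apply/forallP => t; apply: contraT; rewrite negb_exists.
move=> /forallP tP; move: cST; rewrite ltnNge => /negP; case.
have sub : t @: S \subset ~: T.
  apply/subsetP => _ /imsetP[i iS ->]; rewrite inE -(pST i iS).
  apply/imsetP => -[j _ tij]; have /existsP := tP i; case.
  by exists j; apply/eqP.
have := subset_leq_card sub; rewrite card_imset; last exact: perm_inj.
by move=> h; apply: leq_trans (leq_add h (leqnn _)) _; rewrite addnC cardsC card_ord.
Qed.

End Bicliques.

(** * Complete bipartite graphs and disjoint unions *)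

Section BicliqueGraph.
Variables (d : nat) (W : finType).

Definition biclique_rel : rel ('I_d + W) := fun x y =>
  match x, y with inl _, inr _ | inr _, inl _ => true | _, _ => false end.

Lemma biclique_sym : symmetric biclique_rel.
Proof. by move=> [?|?] [?|?]. Qed.

Lemma biclique_irrefl : irreflexive biclique_rel.
Proof. by move=> [?|?]. Qed.

Definition biclique := Graph biclique_sym biclique_irrefl.

Lemma biclique_packsP k : packs_twists biclique k <->
  forall s : W -> {ffun 'I_d -> 'S_k}, exists p, forall w, ~~ blocked (twist (s w) p).
Proof.
split=> pk s.
  pose s' (x y : 'I_d + W) : 'S_k := match x, y with
    | inl j, inr w => s w j | inr w, inl j => ((s w j)^-1)%g | _, _ => 1%g end.
  have [|p pP] := pk s'; first by move=> [?|?] [?|?] /=; rewrite ?invgK ?invg1.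
  exists [ffun j => p (inl j)] => w; apply/negP => /forallP /(_ (p (inr w))).
  move=> /existsP[i /existsP[j]]; rewrite !ffunE permM; apply/negP.
  exact: (pP (inl j) (inr w)).
move=> sV; have [p pP] := pk (fun w => [ffun j => s (inl j) (inr w)]).
have [|t tP] := @choice W 'S_k (fun w t => forall i j,
    t i != s (inl j) (inr w) (p j i)).
  move=> w; have := pP w; rewrite negb_forall => /existsP[t tP]; exists t => i j.
  move: tP; rewrite negb_exists => /forallP/(_ i).
  by rewrite negb_exists => /forallP/(_ j); rewrite !ffunE permM.
exists (fun x => match x with inl j => p j | inr w => t w end).
move=> [j|w] [j'|w'] //= _ i.
by apply: contra (tP w i j') => /eqP->; rewrite (sV (inl j')) permKV.
Qed.

Lemma biclique_packs k : d + d <= k -> packs_twists biclique k.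
Proof.
move=> dk; apply/biclique_packsP => s; exists [ffun=> 1%g] => w.
apply/negP => /blocked_latin[|dk' _]; first exact: leqW.
by rewrite dk' ltnn in dk.
Qed.

End BicliqueGraph.

Section Union.
Variables (V V' : finType) (G : graph V) (G' : graph V').

Definition union_rel : rel (V + V') := fun x y =>
  match x, y with inl u, inl v => G u v | inr u, inr v => G' u v
  | _, _ => false end.

Lemma union_sym : symmetric union_rel.
Proof. by move=> [?|?] [?|?] //=; exact: edge_sym. Qed.

Lemma union_irrefl : irreflexive union_rel.
Proof. by move=> [?|?]; exact: edge_irrefl. Qed.

Definition disjoint_union := Graph union_sym union_irrefl.

Lemma union_packsP k :
  packs_twists disjoint_union k <-> packs_twists G k /\ packs_twists G' k.
Proof.
split=> [pk|[pk pk'] s sV].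
  split=> s sV.
    have [|p pP] := pk (fun x y => match x, y with inl u, inl v => s u v
      | _, _ => 1%g end).
      by move=> [?|?] [?|?]; rewrite ?invg1.
    by exists (p \o inl) => u v; exact: (pP (inl u) (inl v)).
  have [|p pP] := pk (fun x y => match x, y with inr u, inr v => s u v
    | _, _ => 1%g end).
    by move=> [?|?] [?|?]; rewrite ?invg1.
  by exists (p \o inr) => u v; exact: (pP (inr u) (inr v)).
have [|p pP] := pk (fun u v => s (inl u) (inl v)); first by move=> *; exact: sV.
have [|p' pP'] := pk' (fun u v => s (inr u) (inr v)); first by move=> *; exact: sV.
exists (fun x => match x with inl u => p u | inr u => p' u end).
by move=> [u|u] [v|v] //=; [exact: pP|exact: pP'].
Qed.

End Union.

(** * Averaging and greedy covering by twists *)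

Section Counting.
Variables (d k : nat).
Notation tuples := {ffun 'I_d -> 'S_k}.
Implicit Types p s : tuples.

Definition blocked_set : {set tuples} := [set p | blocked p].

Lemma card_tuples : #|{: tuples}| = k`! ^ d.
Proof. by rewrite card_ffun card_ord card_Sn. Qed.

Lemma twist_bij_l p : bijective (fun s => twist s p).
Proof.
exists (fun s => twist s [ffun j => (p j)^-1%g]) => s; apply/ffunP => j;
  by rewrite !ffunE ?mulKg ?mulKVg.
Qed.

(** For fixed [p] the map from [s] to [twist s p] is bijective, so a uniform [s] blocks [p] with the
    density of [blocked_set]; some [s] reaches the average over [R]. *)
Lemma twist_blocks_average (R : {set tuples}) :
  exists s, #|R| * #|blocked_set| <= #|[set p in R | blocked (twist s p)]| * k`! ^ d.
Proof.
apply/existsP; apply: contraT; rewrite negb_exists => /forallP lt.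
have E : \sum_s #|[set p in R | blocked (twist s p)]| = #|R| * #|blocked_set|.
  under eq_bigr do rewrite -sum1dep_card big_mkcondr.
  rewrite exchange_big /= -sum_nat_const; apply: eq_bigr => p _.
  rewrite -big_mkcond sum1dep_card.
  rewrite -[RHS](on_card_preimset (f := fun s => twist s p)).
    by apply: eq_card => s; rewrite !inE.
  exact/onW_bij/twist_bij_l.
have : \sum_s (#|[set p in R | blocked (twist s p)]| * k`! ^ d) <
       \sum_(s : tuples) (#|R| * #|blocked_set|).
  rewrite [X in _ < X](bigD1 [ffun=> 1%g]) // [X in X < _](bigD1 [ffun=> 1%g]) //=.
  rewrite -addSn leq_add ?ltnNge ?lt //.
  by apply: leq_sum => s _; rewrite ltnW // ltnNge lt.
by rewrite -big_distrl E /= sum_nat_const card_tuples mulnC ltnn.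
Qed.

(** Each twist, chosen by averaging, shrinks the unblocked part of [R] at least by the factor one
    minus the density of [blocked_set]; after [N] rounds fewer than one tuple survives. *)
Lemma twists_block_greedy N (R : {set tuples}) :
  #|R| * (k`! ^ d - #|blocked_set|) ^ N < (k`! ^ d) ^ N ->
  exists s : 'I_N -> tuples, forall p, p \in R -> exists w, blocked (twist (s w) p).
Proof.
have ble : #|blocked_set| <= k`! ^ d by rewrite -card_tuples max_card.
have g0 : 0 < k`! ^ d by rewrite expn_gt0 fact_gt0.
elim: N R => [|N IH] R.
  rewrite !expn0 muln1 ltnS leqn0 cards_eq0 => /eqP->.
  by exists (fun=> [ffun=> 1%g]) => p; rewrite inE.
move=> ltR; have [s0 s0P] := twist_blocks_average R.
pose R' := [set p in R | ~~ blocked (twist s0 p)].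
have cR' : #|R'| * k`! ^ d <= #|R| * (k`! ^ d - #|blocked_set|).
  have <- : #|R| - #|[set p in R | blocked (twist s0 p)]| = #|R'|.
    rewrite -[#|R|](cardsID [set p | blocked (twist s0 p)]) -setIdE addKn.
    by apply: eq_card => p; rewrite !inE andbC.
  by rewrite mulnBl mulnBr leq_sub2l.
have [|s sP] := IH R'.
  rewrite -(ltn_pmul2l g0) -expnS; apply: leq_ltn_trans ltR.
  by rewrite mulnA [_ * #|R'|]mulnC expnS mulnA leq_mul2r cR' orbT.
exists (fun w => if unlift ord0 w is Some w' then s w' else s0) => p pR.
have [bp|nbp] := boolP (blocked (twist s0 p)).
  by exists ord0; rewrite unlift_none.
by have [|w wP] := sP p; [rewrite inE pR|exists (lift ord0 w); rewrite liftK].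
Qed.

Lemma blocked_twistMr s p (t : 'S_k) :
  blocked (twist s [ffun j => (t * p j)%g]) -> blocked (twist s p).
Proof.
move=> /forallP b; apply/forallP => u.
have /existsP[i /existsP[j]] := b (t * u)%g; rewrite !ffunE !permM => h.
by apply/existsP; exists (t i); apply/existsP; exists j; rewrite !ffunE permM.
Qed.

End Counting.

(** * Comparing the numbers of blocked tuples for [n] and [n.+1] labels *)

Lemma perm_imset_eq_card (T : finType) (A B : {set T}) :
  #|A| = #|B| -> exists s : {perm T}, s @: A = B.
Proof.
move=> cAB; pose D (s : {perm T}) := s @: A :\: B.
case: (arg_minnP (fun s => #|D s|) (erefl : xpredT (1%g : {perm T}))) => s _ smin.
have csA (t : {perm T}) : #|t @: A| = #|B| by rewrite card_imset //; exact: perm_inj.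
have [D0|[a]] := set_0Vmem (D s).
  by exists s; apply/eqP; rewrite eqEcard csA leqnn andbT -setD_eq0 -/(D s) D0.
rewrite inE => /andP[aB asA].
have [b] : exists b, b \in B :\: s @: A.
  apply/set0Pn; rewrite setD_eq0; apply: contra aB => sub.
  by have /eqP-> : B == s @: A by rewrite eqEcard sub csA leqnn.
rewrite inE => /andP[bsA bB].
have := smin (s * tperm a b)%g isT; rewrite leqNgt => /negP; case.
apply: proper_card; apply/properP; split; last first.
  exists a; first by rewrite inE aB.
  rewrite inE aB /=.
  apply: contra bsA => /imsetP[x xA]; rewrite permM => ax.
  by apply/imsetP; exists x; rewrite // -[s x](tpermK a b) -ax tpermL.
apply/subsetP => y; rewrite !inE => /andP[yB /imsetP[x xA]].
rewrite permM => yx; rewrite yB /=; move: yx; case: tpermP => [_ yb|sb|_ _ ->].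
- by rewrite yb bB in yB.
- by case/negP: bsA; rewrite -sb imset_f.
- by rewrite imset_f.
Qed.

Lemma perm_fix_lift n (s : 'S_n.+1) :
  s ord_max = ord_max -> exists t : 'S_n, s = lift_perm ord_max ord_max t.
Proof.
move=> smax; pose f i := odflt i (unlift ord_max (s (lift ord_max i))).
have fP i : s (lift ord_max i) = lift ord_max (f i).
  rewrite /f; case: unliftP => //= /eqP.
  by rewrite -[X in _ == X]smax (inj_eq perm_inj) eq_sym (negPf (neq_lift _ _)).
have finj : injective f.
  by move=> i j fij; apply/(@lift_inj _ ord_max)/(@perm_inj _ s); rewrite !fP fij.
exists (perm finj); apply/permP => x.
case: (unliftP ord_max x) => [i|] ->; last by rewrite lift_perm_id.
by rewrite lift_perm_lift permE fP.
Qed.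

Lemma latin_relabel d k (S T S' T' : {set 'I_k}) :
  #|S| = #|S'| -> #|T| = #|T'| -> #|latin d S T| <= #|latin d S' T'|.
Proof.
move=> /esym/perm_imset_eq_card[a aS] /perm_imset_eq_card[b bT].
pose f (p : {ffun 'I_d -> 'S_k}) : {ffun 'I_d -> 'S_k} := [ffun j => a * p j * b]%g.
have finj : injective f.
  move=> p q /ffunP fpq; apply/ffunP => j; have := fpq j; rewrite !ffunE.
  by move/mulIg/mulgI.
rewrite -(card_imset _ finj); apply/subset_leq_card/subsetP => _ /imsetP[p pST ->].
apply/latinP => i iS'; rewrite -bT -(latinP _ _ _ pST (a i)); last by rewrite -aS imset_f.
rewrite /row_image -imset_comp; apply: eq_imset => j.
by rewrite !ffunE !permM.
Qed.

(* Composing each permutation with the transposition of [ord_max] and its value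
   there makes [ord_max] a fixed point; nothing is lost, since that value is the
   one symbol of [T] missing in the smaller rectangle. *)
Lemma latin_restrict d n (S T : {set 'I_n}) : #|T| = #|S|.+1 ->
  #|latin d (ord_max |: lift ord_max @: S) (lift ord_max @: T)| <= #|latin d S T|.
Proof.
move=> cST; set S' := _ |: _; set T' := _ @: T.
have [|F FE] := @choice 'S_n.+1 'S_n (fun s t =>
  s * tperm (s ord_max) ord_max = lift_perm ord_max ord_max t)%g.
  by move=> s; apply: perm_fix_lift; rewrite permM tpermL.
pose f (p : {ffun 'I_d -> 'S_n.+1}) : {ffun 'I_d -> 'S_n} := [ffun j => F (p j)].
have cS' : #|S'| = #|T'|.
  rewrite cardsU1 !card_imset; try exact: lift_inj.
  rewrite cST; case: imsetP => // -[x _ /eqP].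
  by rewrite (negPf (neq_lift _ _)).
have maxT : ord_max \notin T'.
  by apply/imsetP => -[x _ /eqP]; rewrite (negPf (neq_lift _ _)).
have pT p j x : p \in latin d S' T' -> x \in S' -> p j x \in T'.
  by move=> /latinP pS xS; rewrite -(pS x xS) imset_f.
have fE p j i : p \in latin d S' T' -> i \in S ->
    lift ord_max (f p j i) = p j (lift ord_max i).
  move=> pl iS; rewrite ffunE -(lift_perm_lift ord_max) -FE permM tpermD //.
    by rewrite (inj_eq perm_inj) neq_lift.
  apply: contraNneq maxT => ->; apply: pT => //.
  by rewrite !inE imset_f ?orbT.
have finj : {in latin d S' T' &, injective f}.
  move=> p q pl ql fpq; apply/ffunP => j.
  have Fpq : F (p j) = F (q j) by have /ffunP/(_ j) := fpq; rewrite !ffunE.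
  suff maxE : p j ord_max = q j ord_max.
    by have := FE (p j); rewrite Fpq -FE maxE => /mulIg.
  have qS : q j @: S' = T'.
    apply/eqP; rewrite eqEcard (card_imset _ (@perm_inj _ (q j))) cS' leqnn andbT.
    by apply/subsetP => _ /imsetP[x xS ->]; exact: pT.
  have maxS : ord_max \in S' by rewrite !inE eqxx.
  have := pT _ j _ pl maxS; rewrite -qS => /imsetP[x].
  rewrite !inE => /orP[/eqP -> //|/imsetP[i iS ->]].
  by rewrite -fE // -fpq fE // => /perm_inj /eqP; rewrite (negPf (neq_lift _ _)).
rewrite -(card_in_imset finj); apply/subset_leq_card/subsetP => _ /imsetP[p pl ->].
apply/latinP => i iS; apply: (imset_inj (@lift_inj _ ord_max)).
have := latinP _ _ _ pl (lift ord_max i); rewrite -/T' => <-; last first.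
  by rewrite !inE imset_f ?orbT.
rewrite /row_image -imset_comp; apply: eq_imset => j /=; exact: fE.
Qed.

Lemma bin_pred_le m c : c <= m.+1 -> 1 < m -> 'C(c, m) <= c.
Proof.
rewrite leq_eqVlt ltnS leq_eqVlt => /or3P[/eqP->|/eqP->|cm] m1.
- by rewrite binSn.
- by rewrite binn ltnW.
- by rewrite bin_small.
Qed.

(** A symbol occurs in at most [d] rows, so [T] is the image of [c <= m.+1] rows and contributes
    ['C(c, m) <= c]. Every row has one image, so these [c] sum to at most [n]. *)
Lemma latin_multiplicity d n (p : {ffun 'I_d -> 'S_n}) m : d = m.+1 -> 1 < m ->
  \sum_(T : {set 'I_n} | #|T| == d)
    #|[set S : {set 'I_n} | (#|S| == m) && (p \in latin d S T)]| <= n.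
Proof.
move=> dm m1; pose K (T : {set 'I_n}) := [set i | row_image p i == T].
apply: (@leq_trans (\sum_(T : {set 'I_n} | #|T| == d) #|K T|)).
  apply: leq_sum => T /eqP cT.
  have -> : [set S : {set 'I_n} | (#|S| == m) && (p \in latin d S T)]
      = [set S : {set 'I_n} | S \subset K T & #|S| == m].
    apply/setP => S; rewrite !inE andbC; congr (_ && _).
    by apply/forall_inP/subsetP => h i /h; rewrite inE.
  rewrite cards_draws bin_pred_le // -dm.
  have /card_gt0P[l lT] : 0 < #|T| by rewrite cT dm.
  apply: leq_trans (card_col_image p l); apply/subset_leq_card/subsetP => i.
  by rewrite !inE => /eqP->.
apply: (@leq_trans (\sum_(T : {set 'I_n}) #|K T|)).
  by rewrite [leqRHS](bigID (fun T : {set 'I_n} => #|T| == d)) leq_addr.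
under eq_bigr do rewrite -sum1dep_card.
rewrite -[leqRHS]card_ord -sum1_card.
by rewrite [leqRHS](partition_big (row_image p) xpredT).
Qed.

Lemma sum_const_draws n m x : \sum_(S : {set 'I_n} | #|S| == m) x = 'C(n, m) * x.
Proof.
rewrite sum_nat_const; congr (_ * _).
by rewrite -[in RHS](card_ord n) -card_draws; apply: eq_card => S; rewrite [RHS]inE.
Qed.

(** Double counting of triples [(S, T, p)]: since [m + m.+1 > n], every [p] in [latin m.+1 S T] is
    blocked, and a blocked [p] is counted at most [n] times. *)
Lemma blocked_latin_lower n m a : n = m + m -> 1 < m ->
  (forall S T : {set 'I_n}, #|S| = m -> #|T| = m.+1 -> a <= #|latin m.+1 S T|) ->
  'C(n, m) * 'C(n, m.+1) * a <= #|blocked_set m.+1 n| * n.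
Proof.
move=> nm m1 aP.
apply: (@leq_trans (\sum_(S : {set 'I_n} | #|S| == m)
    \sum_(T : {set 'I_n} | #|T| == m.+1) #|latin m.+1 S T|)).
  rewrite -mulnA -sum_const_draws; apply: leq_sum => S /eqP cS.
  by rewrite -sum_const_draws; apply: leq_sum => T /eqP cT; exact: aP.
rewrite exchange_big /=.
have E (T : {set 'I_n}) : #|T| == m.+1 ->
  \sum_(S : {set 'I_n} | #|S| == m) #|latin m.+1 S T| =
  \sum_(p in blocked_set m.+1 n)
    #|[set S : {set 'I_n} | (#|S| == m) && (p \in latin m.+1 S T)]|.
  move=> /eqP cT.
  under [RHS]eq_bigr do rewrite -sum1dep_card big_mkcondr.
  rewrite exchange_big /=; apply: eq_bigr => S /eqP cS.
  rewrite -big_mkcondr sum1dep_card; apply: eq_card => p; rewrite [RHS]inE.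
  case: (boolP (p \in latin m.+1 S T)) => pl; last by rewrite andbF.
  by rewrite inE (latin_blocked _ pl) // cS cT nm addnS.
rewrite (eq_bigr _ E) exchange_big /= -sum_nat_const.
by apply: leq_sum => p _; exact: latin_multiplicity.
Qed.

Lemma card_bigcup_le_sum (T I : finType) (P : pred I) (F : I -> {set T}) :
  #|\bigcup_(i | P i) F i| <= \sum_(i | P i) #|F i|.
Proof.
elim/big_rec2: _ => [|i m A _ le]; first by rewrite cards0.
by apply: leq_trans (leq_card_setU _ _) _; rewrite leq_add2l.
Qed.

Lemma blocked_latin_upper k d : d + d = k.+1 ->
  #|blocked_set d k| <=
  \sum_(S : {set 'I_k} | #|S| == d) \sum_(T : {set 'I_k} | #|T| == d) #|latin d S T|.
Proof.
move=> dk.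
have sub : blocked_set d k \subset \bigcup_(S : {set 'I_k} | #|S| == d)
    \bigcup_(T : {set 'I_k} | #|T| == d) latin d S T.
  apply/subsetP => p; rewrite inE => /blocked_latin[|_ [S [T [cS cT pST]]]].
    by rewrite dk.
  apply/bigcupP; exists S; first exact/eqP.
  by apply/bigcupP; exists T; first exact/eqP.
apply: leq_trans (subset_leq_card sub) _.
apply: leq_trans (card_bigcup_le_sum _ _) _; apply: leq_sum => S _.
exact: card_bigcup_le_sum.
Qed.

(** By [latin_restrict], Latin squares for [n.+1] labels are at most as many as [m] by [m.+1]
    rectangles for [n] labels. The union bound and the double count then differ by
    [C^2 * n / (A * B) = 2 * n.+1 ^ 2 / m.+1]. *)
Lemma blocked_ratio m : 1 < m ->
  m.+1 * #|blocked_set m.+1 (m + m).+1| <=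
  2 * (m + m).+1 ^ 2 * #|blocked_set m.+1 (m + m)|.
Proof.
move=> m1; set n := m + m; set b := #|blocked_set m.+1 n|.
pose A := 'C(n, m); pose B := 'C(n, m.+1); pose C := 'C(n.+1, m.+1).
have A0 : 0 < A by rewrite bin_gt0 leq_addr.
have B0 : 0 < B by rewrite bin_gt0 -addn1 leq_add2l ltnW.
have lat (S T : {set 'I_n.+1}) : #|S| = m.+1 -> #|T| = m.+1 ->
    A * B * #|latin m.+1 S T| <= b * n.
  move=> cS cT; apply: blocked_latin_lower => // S' T' cS' cT'.
  apply: leq_trans (latin_restrict _ _); last by rewrite cS' cT'.
  apply: latin_relabel; last by rewrite card_imset ?cT' //; exact: lift_inj.
  rewrite cS cardsU1 card_imset ?cS'; last exact: lift_inj.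
  by case: imsetP => // -[x _ /eqP]; rewrite (negPf (neq_lift _ _)).
have upper : A * B * #|blocked_set m.+1 n.+1| <= C * (C * (b * n)).
  have := @blocked_latin_upper n.+1 m.+1; rewrite addnS addSn => /(_ erefl) h.
  apply: leq_trans (leq_mul (leqnn _) h) _; rewrite big_distrr /=.
  rewrite -(sum_const_draws n.+1 m.+1); apply: leq_sum => S /eqP cS.
  rewrite big_distrr -(sum_const_draws n.+1 m.+1) /=.
  by apply: leq_sum => T /eqP cT; exact: lat.
have EA : n.+1 * A = m.+1 * C by rewrite /A /C mul_bin_diag.
have EB : n.+1 * B = m * C.
  have := mul_bin_down n.+1 m.+1; rewrite /= => ->.
  by rewrite subSS addnK.
rewrite -(leq_pmul2l (_ : 0 < A * B * m)); last by rewrite !muln_gt0 A0 B0 ltnW.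
apply: (@leq_trans (m.+1 * m * (A * B * #|blocked_set m.+1 n.+1|))); first by apply: eq_leq; ring.
apply: leq_trans (leq_mul (leqnn _) upper) _.
rewrite (_ : _ * _ = (m.+1 * C) * (m * C) * (b * n)); last by ring.
by rewrite -EA -EB /n; apply: eq_leq; ring.
Qed.

(** The cyclic Latin square on the first [minn d k] labels, extended by the identity, blocks because
    [k < 2 * minn d k]. *)
Lemma blocked_exists d k : 0 < k < d + d -> exists p : {ffun 'I_d -> 'S_k}, blocked p.
Proof.
move=> /andP[k0 kd]; pose m := minn d k.
have m0 : 0 < m by rewrite /m; lia.
have mk : m <= k by rewrite geq_minr.
have rk j (i : 'I_k) : (if i < m then (i + j) %% m else i) < k.
  by case: ifP => // _; apply: leq_trans (ltn_pmod _ m0) mk.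
pose r j i := Ordinal (rk j i).
have rinj j : injective (r j).
  move=> i i' /(congr1 val) /= rii; apply/val_inj => /=; move: rii.
  case: ifP => im; case: ifP => im' // E.
  - by move/eqP: E; rewrite eqn_modDr !modn_small // => /eqP.
  - by rewrite -E ltn_pmod in im'.
  - by rewrite E ltn_pmod in im.
exists [ffun j : 'I_d => perm (rinj j)].
pose S := [set i : 'I_k | i < m].
have cS : #|S| = m.
  have -> : S = [set widen_ord mk i | i : 'I_m].
    apply/setP => i; rewrite inE; apply/idP/imsetP => [im|[j _ ->] /=]; last exact: ltn_ord.
    by exists (Ordinal im) => //; apply: val_inj.
  rewrite card_imset ?card_ord // => i j /(congr1 val) /= ij; exact: val_inj.
apply: (@latin_blocked _ _ S S); first by rewrite cS /m; lia.
apply/latinP => i; rewrite inE => im; apply/setP => l; rewrite inE.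
apply/imsetP/idP => [[j _ ->]|lm]; first by rewrite ffunE permE /= im ltn_pmod.
have jd : (l + (m - i)) %% m < d.
  by apply: leq_trans (ltn_pmod _ m0) (geq_minl _ _).
exists (Ordinal jd) => //; apply: val_inj; rewrite ffunE permE /= im modnDmr.
by rewrite addnCA subnKC ?modnDr ?modn_small // ltnW.
Qed.

(** * Numerical estimates *)

Section ExpnGap.
Import Order.TTheory GRing.Theory Num.Theory.

(* AM-GM applied to [s] copies of [1 - b / g] and [t] copies of [1 + 1 / m],
   cleared of denominators. *)
Lemma expn_gap (g b s t m : nat) : 0 < g -> 0 < m -> b <= g ->
  t * g <= s * b * m -> (g - b) ^ s * m.+1 ^ t <= g ^ s * m ^ t.
Proof.
move=> g0 m0 bg tg.
have [st0|st0] := posnP (s + t).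
  by have [-> ->] : s = 0 /\ t = 0 by lia.
pose E (x : 'I_s + 'I_t) : rat :=
  if x is inl _ then ((g - b) * m)%:R%R else (m.+1 * g)%:R%R.
have [|+ _] := @leif_AGM rat ('I_s + 'I_t)%type predT E.
  by move=> [?|?] _; rewrite ler0n.
rewrite /= !big_sumType /= !prodr_const !sumr_const !card_ord card_sum !card_ord.
have mu_le : ((((g - b) * m)%:R *+ s + (m.+1 * g)%:R *+ t) / (s + t)%:R <=
    (g * m)%:R :> rat)%R.
  rewrite ler_pdivrMr ?ltr0n // -!mulrnA -natrD -natrM ler_nat.
  have bms : b * m * s <= g * m * s by rewrite !leq_mul2r bg !orbT.
  have tg' : g * t <= b * m * s by rewrite mulnC [leqRHS]mulnC mulnA.
  rewrite !mulnBl mulnDr mulSn mulnDl [m * g]mulnC.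
  by lia.
move=> /le_trans/(_ (lerXn2r (s + t) _ _ mu_le)).
rewrite -!natrX -natrM ler_nat => h.
have {h} : ((g - b) * m) ^ s * (m.+1 * g) ^ t <= (g * m) ^ (s + t).
  apply: h; rewrite nnegrE ?ler0n //.
  by rewrite divr_ge0 ?addr_ge0 ?mulrn_wge0 ?ler0n.
rewrite !expnMn !expnD => h.
rewrite -(leq_pmul2r (_ : 0 < m ^ s * g ^ t)); last by rewrite muln_gt0 !expn_gt0 g0 m0.
by apply: leq_trans (leq_trans h _); apply: eq_leq; ring.
Qed.

End ExpnGap.

Lemma fact_sqr_le n : n`! ^ 2 <= 2 ^ (n * n.-1).
Proof.
elim: n => // n IH; rewrite factS expnMn /=.
have -> : n.+1 * n = n * 2 + n * n.-1 by case: n {IH} => // n; rewrite /=; nia.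
by rewrite expnD leq_mul // expnM leq_exp2r // ltn_expl.
Qed.

Lemma Z_of_nat_expn (a b : nat) : Z.of_nat (a ^ b) = Z.pow (Z.of_nat a) (Z.of_nat b).
Proof.
elim: b => // b IH; rewrite expnS Nat2Z.inj_mul IH Nat2Z.inj_succ Z.pow_succ_r //.
exact: Zle_0_nat.
Qed.

Lemma ltn_expn_of_Z a b c d :
  Z.lt (Z.pow (Z.of_nat a) (Z.of_nat b)) (Z.pow (Z.of_nat c) (Z.of_nat d)) ->
  a ^ b < c ^ d.
Proof. by rewrite -!Z_of_nat_expn => /Nat2Z.inj_lt/ltP. Qed.

(* [m.+1 * (m + m).+1 ^ m.-1 - 2] bounds from below twice the expected number of
   right vertices at which random twists block a given packing of the left side,
   and [(m + m)`! ^ m] counts these packings up to a common relabelling. *)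
Lemma fact_beaten m : 1 < m -> exists c, 0 < c /\
  ((m + m)`! ^ m) ^ 2 * c ^ ((m.+1 * (m + m).+1 ^ m.-1 - 2) * c)
    < c.+1 ^ ((m.+1 * (m + m).+1 ^ m.-1 - 2) * c).
Proof.
move=> m1; have [->|m3] : m = 2 \/ 2 < m by lia.
  have E1 : (2 + 2)`! = 24 by [].
  have E2 : (3 * (2 + 2).+1 ^ 2.-1 - 2) * 24 = 312 by [].
  have E3 : 2 * 2 + 312 = 316 by [].
  (* [24 ^ 4] is below [exp 13] but far above [2 ^ 13], so [(1 + 1/c)^c] must be near [exp 1].
     Taking [c = 24] merges the left side into one power: [24 ^ 316 < 25 ^ 312]. *)
  exists 24; split; first by [].
  rewrite E1 E2 -expnM -expnD E3; apply: ltn_expn_of_Z.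
  by vm_compute.
(* With [m.-1] lowered to 2, the exponents compare as [4m^3 - 2m^2 < 4m^3 + 8m^2 + 5m - 1], so base
   2 is enough. *)
exists 1; split=> //; rewrite exp1n !muln1.
have -> : ((m + m)`! ^ m) ^ 2 = ((m + m)`! ^ 2) ^ m by rewrite -!expnM mulnC.
apply: (@leq_ltn_trans (2 ^ ((m + m) * (m + m).-1 * m))).
  by rewrite expnM leq_exp2r ?fact_sqr_le // ltnW.
rewrite ltn_exp2l //.
apply: (@leq_trans (m.+1 * (m + m).+1 ^ 2 - 2)); last first.
  by rewrite leq_sub2r // leq_mul2l leq_exp2l //; lia.
rewrite -subn1; nia.
Qed.

(** * Choosing the size of the right side *)

Lemma biclique_packs_few N d k : N * #|blocked_set d k| < k`! ^ d ->
  packs_twists (biclique d 'I_N) k.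
Proof.
move=> ltN; apply/biclique_packsP => s.
pose Bad := \bigcup_(w : 'I_N) [set p | blocked (twist (s w) p)].
have : #|Bad| < #|{: {ffun 'I_d -> 'S_k}}|.
  rewrite card_tuples; apply: leq_ltn_trans ltN.
  apply: leq_trans (card_bigcup_le_sum _ _) _.
  rewrite -[in leqRHS](card_ord N) -sum_nat_const; apply: leq_sum => w _.
  apply: eq_leq; rewrite -[RHS](on_card_preimset (f := twist (s w))).
    by apply: eq_card => p; rewrite !inE.
  apply: onW_bij; exists (twist [ffun j => (s w j)^-1%g]) => p;
    by apply/ffunP => j; rewrite !ffunE ?mulgK ?mulgKV.
move=> lt; have /existsP[p pB] : [exists p, p \notin Bad].
  rewrite -negb_forall; apply/negP => /forallP full; move: lt.
  by rewrite -cardsT (_ : Bad = setT) ?ltnn //; apply/setP => p; rewrite full inE.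
exists p => w; apply: contra pB => bp; apply/bigcupP; exists w => //.
by rewrite inE.
Qed.

Lemma biclique_not_packs_greedy N m k :
  k`! ^ m * (k`! ^ m.+1 - #|blocked_set m.+1 k|) ^ N < (k`! ^ m.+1) ^ N ->
  ~ packs_twists (biclique m.+1 'I_N) k.
Proof.
move=> ltN /biclique_packsP pk.
(* A common left factor only renames the colourings, so blocking the tuples with first entry [1%g]
   is enough; this saves a factor of [k] factorial. *)
pose R := [set p : {ffun 'I_m.+1 -> 'S_k} | p ord0 == 1%g].
have cR : #|R| <= k`! ^ m.
  pose f (p : {ffun 'I_m.+1 -> 'S_k}) : {ffun 'I_m -> 'S_k} := [ffun j => p (lift ord0 j)].
  have finj : {in R &, injective f}.
    move=> p q; rewrite !inE => /eqP p0 /eqP q0 /ffunP fpq; apply/ffunP => j.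
    case: (unliftP ord0 j) => [i ->|->]; last by rewrite p0 q0.
    by have := fpq i; rewrite !ffunE.
  by rewrite -(card_in_imset finj) -card_tuples max_card.
have [|s sP] := @twists_block_greedy m.+1 k N R.
  by apply: leq_ltn_trans ltN; rewrite leq_mul2r cR orbT.
have [p pP] := pk s; pose q : {ffun 'I_m.+1 -> 'S_k} := [ffun j => (p ord0)^-1 * p j]%g.
have [|w] := sP q; first by rewrite inE ffunE mulVg.
by move=> /blocked_twistMr; apply/negP.
Qed.

(** Every tuple of twists occurs at some right vertex, so whatever the left side [p], one of them
    carries it to the blocked tuple [q]. *)
Lemma biclique_not_packs N d k : 0 < k < d + d -> k`! ^ d <= N ->
  ~ packs_twists (biclique d 'I_N) k.
Proof.
move=> kd ltN /biclique_packsP pk; have [q qb] := blocked_exists kd.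
pose e := enum {: {ffun 'I_d -> 'S_k}}.
have [p pP] := pk (fun w => nth q e w).
pose r : {ffun 'I_d -> 'S_k} := [ffun j => (p j)^-1 * q j]%g.
have re : index r e < N.
  by apply: leq_trans ltN; rewrite -card_tuples cardE index_mem mem_enum.
have := pP (Ordinal re); rewrite /= nth_index ?mem_enum // => /negP; apply.
by rewrite (_ : twist r p = q) //; apply/ffunP => j; rewrite !ffunE mulKVg.
Qed.

Lemma biclique_gap m : 1 < m -> exists N,
  packs_twists (biclique m.+1 'I_N) (m + m).+1 /\
  ~ packs_twists (biclique m.+1 'I_N) (m + m).
Proof.
move=> m1; set n := m + m; set b' := #|blocked_set m.+1 n.+1|.
set b := #|blocked_set m.+1 n|; set g := n`! ^ m.+1.
have b'0 : 0 < b'.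
  have [|p pb] := @blocked_exists m.+1 n.+1; first by rewrite /n; lia.
  by apply/card_gt0P; exists p; rewrite inE.
have g'0 : 0 < n.+1`! ^ m.+1 by rewrite expn_gt0 fact_gt0.
have g0 : 0 < g by rewrite expn_gt0 fact_gt0.
(* The largest [N] for which the union bound gives a packing with [n.+1] labels. *)
pose N := (n.+1`! ^ m.+1).-1 %/ b'.
exists N; split.
  by apply: biclique_packs_few; rewrite -[ltnRHS](prednK g'0) ltnS leq_trunc_div.
apply: biclique_not_packs_greedy; rewrite -/g -/b.
have bg : b <= g by rewrite /g -card_tuples max_card.
pose Q := m.+1 * n.+1 ^ m.-1.
(* Maximality of [N] and [blocked_ratio] give [N.+1 * b / g >= Q / 2]; passing to [N] costs at most
   1 as [b <= g], hence [Q - 2]. *)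
have QN : (Q - 2) * g <= (N * 2) * b.
  have ratio := blocked_ratio m1; rewrite -/n -/b -/b' in ratio.
  have : n.+1`! ^ m.+1 <= N.+1 * b' by rewrite -[leqLHS](prednK g'0) ltn_ceil.
  rewrite factS expnMn -/g => ceilN.
  have : m.+1 * (n.+1 ^ m.+1 * g) <= N.+1 * (2 * n.+1 ^ 2 * b).
    apply: leq_trans (leq_mul (leqnn m.+1) ceilN) _.
    by rewrite mulnCA leq_mul2l ratio orbT.
  have -> : m.+1 * (n.+1 ^ m.+1 * g) = n.+1 ^ 2 * (Q * g).
    rewrite /Q -{2}(prednK (ltnW m1)) -addn2 expnD; ring.
  have -> : N.+1 * (2 * n.+1 ^ 2 * b) = n.+1 ^ 2 * (N.+1 * 2 * b) by ring.
  rewrite leq_pmul2l ?expn_gt0 // => le.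
  rewrite mulnBl leq_subLR; apply: leq_trans le _.
  by rewrite mulSn mulnDl leq_add2r leq_mul2l bg.
have [c [c0 cP]] := fact_beaten m1; rewrite -/n -/Q in cP.
set t := (Q - 2) * c in cP.
have gap : (g - b) ^ (N * 2) * c.+1 ^ t <= g ^ (N * 2) * c ^ t.
  by apply: expn_gap => //; rewrite /t mulnAC leq_mul2r QN orbT.
(* Squaring produces the exponent [N * 2] of [gap] and avoids halving [Q - 2]. *)
rewrite -(ltn_exp2r _ _ (isT : 0 < 2)) expnMn -!(expnM _ N 2).
rewrite -(ltn_pmul2r (_ : 0 < c.+1 ^ t)) ?expn_gt0 // -mulnA.
apply: leq_ltn_trans (leq_mul (leqnn _) gap) _.
by rewrite mulnCA ltn_pmul2l ?(expn_gt0 g) ?g0.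
Qed.

(** * Realising the values *)

Lemma correspondence_packing_number_eq (V : finType) (G : graph V) z : 0 < z ->
  packs_twists G z -> (forall k, 0 < k < z -> ~ packs_twists G k) ->
  correspondence_packing_number G = z.
Proof.
move=> z0 pz npz; rewrite /correspondence_packing_number.
case: ex_minnP => k /asboolP/always_packsP[k0 pk] kmin.
apply/eqP; rewrite eqn_leq kmin; last by apply/asboolP/always_packsP.
by rewrite leqNgt; apply/negP => kz; apply: (npz k); rewrite ?k0.
Qed.

Theorem theorem1 :
  forall z : nat,
    (exists (V : finType) (G : graph V), correspondence_packing_number G = z)
    <-> 0 < z /\ z <> 3.
Proof.
move=> z; split=> [[V [G]]|[z0 z3]].
  rewrite /correspondence_packing_number.
  case: ex_minnP => k /asboolP/always_packsP[k0 pk] kmin <-; split=> // k3.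
  rewrite k3 in pk kmin.
  have [[eps /unbalanced_not_packs3]|p2] := unbalanced_or_packs2 G; first exact.
  have : 3 <= 2 by apply: kmin; apply/asboolP/always_packsP.
  by [].
have [->|[[m [m0 zm]]|[m [m1 zm]]]] : z = 1 \/
    (exists m, 0 < m /\ z = m + m) \/ exists m, 1 < m /\ z = (m + m).+1.
  have := odd_double_half z; rewrite -addnn; case: odd => /= zE.
    have [h0|h0] : z./2 = 0 \/ 1 < z./2 by lia.
      by left; rewrite -zE h0.
    by right; right; exists z./2; split=> //; rewrite -[LHS]zE.
  by right; left; exists z./2; split; lia.
- exists _, (biclique 0 'I_0); apply: correspondence_packing_number_eq => //.
    exact: biclique_packs.
  by move=> [|[|k]].
(* The right side is sized by [z] so that it serves every [k < z] at once. *)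
- exists _, (biclique m 'I_(z`! ^ m)); apply: correspondence_packing_number_eq => //.
    by apply: biclique_packs; rewrite zm.
  move=> k /andP[k0 kz]; apply: biclique_not_packs; first by rewrite k0 -zm.
  by rewrite leq_exp2r // leq_fact // ltnW.
(* The gap graph is used to exclude [k = m + m], and the second component excludes all smaller
   [k]. *)
have [N [pN npN]] := biclique_gap m1.
exists _, (disjoint_union (biclique m.+1 'I_N) (biclique m 'I_((m + m)`! ^ m))).
apply: correspondence_packing_number_eq => // [|k /andP[k0 kz]].
  by rewrite zm; apply/union_packsP; split=> //; exact/biclique_packs/leqnSn.
move=> /union_packsP[pk pk']; move: kz; rewrite zm ltnS leq_eqVlt.
case/orP=> [/eqP km|km]; first by rewrite km in pk.
apply: (biclique_not_packs _ _ pk'); first by rewrite k0.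
by rewrite leq_exp2r ?leq_fact // ltnW // ltnW.
Qed.
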